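(* Let $n$ and $m$ be positive even integers, so that $$C_n\times C_m=(C_{2^{\alpha_1}}\times C_{2^{\beta_1}})\times(C_{\mathrm p_2^{\alpha_2}}\times C_{\mathrm p_2^{\beta_2}})\times\cdots\times(C_{\mathrm p_s^{\alpha_s}}\times C_{\mathrm p_s^{\beta_s}}),$$ where $\alpha_1\ge1$, $\beta_1\ge1$, $\mathrm p_2,\dots,\mathrm p_s$ are distinct odd primes and $\alpha_i\ge0$, $\beta_i\ge0$ for $i\in\{2,\dots,s\}$; put $\mathrm p_1=2$. Every cyclic subgroup $\mathcal C$ of $C_n\times C_m\subset SO(2)\times SO(2)$ which contains the element $(-I,-I)$ is written uniquely in the form $$\mathcal C=\mathrm A_1\times\mathrm A_2\times\cdots\times\mathrm A_s,$$ where, for $i\in\{2,\dots,s\}$, $\mathrm A_i$ is a cyclic subgroup (possibly trivial) of $C_{\mathrm p_i^{\alpha_i}}\times C_{\mathrm p_i^{\beta_i}}$, and $\mathrm A_1$ is one of the following cyclic subgroups of $C_{2^{\alpha_1}}\times C_{2^{\beta_1}}$: $$\left\{\left(R\left(\tfrac{2\pi}{2^{\kappa}}\,r\,i_1\right),R\left(\tfrac{2\pi}{2^{\kappa}}\,i_1\right)\right):\ i_1\in\{0,1,\dots,2^{\kappa}-1\}\right\},$$ with $1\le\kappa\le\min(\alpha_1,\beta_1)$ and with $r$, which parametrises the groups, taking values in $\{1,2,\dots,2^{\kappa}-1\}\setminus\{2,2\cdot2,\dots,(2^{\kappa-1}-1)2\}$. Moreover, a generator of $\mathcal C$ is given by $(x^{\mathcal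 A},y^{\mathcal B})$, where $x$ is a generator of $C_n$, $y$ is a generator of $C_m$, and $$\mathcal A=\sum_{i=1}^{\nu}r_ip_i^{a_i-k_i}\frac{n}{p_i^{a_i}}+\sum_{i=\nu+1}^{\nu+\chi}p_i^{a_i-k_i}\frac{n}{p_i^{a_i}}+\sum_{i=\nu+\chi+1}^{\nu+\chi+\tau}j_i\frac{n}{p_i^{a_i}}+\sum_{i=\nu+\chi+\tau+1}^{\nu+\chi+\tau+\psi}p_i^{a_i-k_i}\frac{n}{p_i^{a_i}},$$ $$\mathcal B=\sum_{i=1}^{\nu}p_i^{b_i-k_i}\frac{m}{p_i^{b_i}}+\sum_{i=\nu+1}^{\nu+\chi}\rho_ip_i^{b_i-k_i+1}\frac{m}{p_i^{b_i}}+\sum_{i=\nu+\chi+1}^{\nu+\chi+\tau}p_i^{b_i-k_i}\frac{m}{p_i^{b_i}}+\sum_{i=\nu+\chi+\tau+1}^{\nu+\chi+\tau+\psi}j_i\frac{m}{p_i^{b_i}},$$ for some values of the parameters satisfying the following restrictions: - $\nu,\chi,\tau,\psi$ are non-negative integers with $\nu+\chi+\tau+\psi\le s$, and $(p_i^{a_i},p_i^{b_i})$, $i=1,\dots,s$, is a permutation of the $s$ pairs $(\mathrm p_1^{\alpha_1},\mathrm p_1^{\beta_1}),\dots,(\mathrm p_s^{\alpha_s},\mathrm p_s^{\beta_s})$; - one of the primes $p_1,\dots,p_\nu$ is $2$; if $p_t=2$, then $1\le k_t\le\min(a_t,b_t)$ and $r_t\in\{1,\dots,2^{k_t}-1\}\setminus\{2,2\cdot2,\dots,(2^{k_t-1}-1)2\}$;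 - for $i\in\{1,\dots,\nu\}\setminus\{t\}$: $k_i\le\min(a_i,b_i)$ and $r_i\in\{0,1,\dots,p_i^{k_i}-1\}$; - for $\nu<i\le\nu+\chi$: $1\le k_i\le\min(a_i,b_i)$ and $\rho_i\in\{0,1,\dots,p_i^{k_i-1}-1\}$; - for $\nu+\chi<i\le\nu+\chi+\tau$: $a_i<k_i\le b_i$ and $j_i\in\{0,1,\dots,p_i^{a_i}-1\}$; - for $\nu+\chi+\tau<i\le\nu+\chi+\tau+\psi$: $b_i<k_i\le a_i$ and $j_i\in\{0,1,\dots,p_i^{b_i}-1\}$. Some, or all, of the exponents $a_i,b_i$ with $i\ne t$ may be zero.
   Context: $R(\theta)=\begin{pmatrix}\cos\theta&\sin\theta\\-\sin\theta&\cos\theta\end{pmatrix}$; $C_N=\{R(2\pi r/N):0\le r\le N-1\}$ is the cyclic subgroup of order $N$ of $SO(2)$, and for $N'\mid N$ one regards $C_{N'}\subset C_N$. The direct product decompositions are internal direct products of subgroups of $SO(2)\times SO(2)$. Empty sums are $0$. The $k_i$ are non-negative integers. *)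

(* Defs.v *)
From HB Require Import structures.
From mathcomp Require Import all_boot all_order all_algebra all_fingroup.
From mathcomp Require Import all_classical all_reals all_analysis.
From mathcomp Require Import ring.

Set Implicit Arguments.
Unset Strict Implicit.
Unset Printing Implicit Defensive.

Import Order.TTheory GRing.Theory Num.Theory.

Local Open Scope classical_set_scope.
Local Open Scope ring_scope.

Section SpecialOrthogonalGroup.
Variable K : realType.

Definition is_SO2 (A : 'M[K]_2) : bool := (A *m A^T == 1%:M) && (\det A == 1).

Record SO2 := MkSO2 { SO2_val :> 'M[K]_2; SO2_prop : is_SO2 SO2_val }.

HB.instance Definition _ := [isSub for SO2_val].
HB.instance Definition _ := [Choice of SO2 by <:].

Fact SO2_one_subproof : is_SO2 1%:M.
Proof. by rewrite /is_SO2 trmx1 mulmx1 det1 !eqxx. Qed.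

Fact SO2_mul_subproof (A B : SO2) : is_SO2 (A *m B).
Proof.
case: A B => [A /andP[/eqP oA /eqP dA]] [B /andP[/eqP oB /eqP dB]] /=.
by rewrite /is_SO2 det_mulmx dA dB mul1r trmx_mul -mulmxA (mulmxA B) oB mul1mx
  oA !eqxx.
Qed.

Fact SO2_inv_subproof (A : SO2) : is_SO2 (A^T).
Proof.
case: A => [A /andP[/eqP oA /eqP dA]] /=.
by rewrite /is_SO2 det_tr dA trmxK (mulmx1C oA) !eqxx.
Qed.

Definition SO2_one : SO2 := MkSO2 SO2_one_subproof.
Definition SO2_mul (A B : SO2) : SO2 := MkSO2 (SO2_mul_subproof A B).
Definition SO2_inv (A : SO2) : SO2 := MkSO2 (SO2_inv_subproof A).

Fact SO2_mulA : associative SO2_mul.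
Proof. by move=> A B C; apply: val_inj; rewrite /= mulmxA. Qed.
Fact SO2_1mul : left_id SO2_one SO2_mul.
Proof. by move=> A; apply: val_inj; rewrite /= mul1mx. Qed.
Fact SO2_mul1 : right_id SO2_one SO2_mul.
Proof. by move=> A; apply: val_inj; rewrite /= mulmx1. Qed.
Fact SO2_mulV : right_inverse SO2_one SO2_inv SO2_mul.
Proof. by move=> A; apply: val_inj; case: A => A /= /andP[/eqP]. Qed.
Fact SO2_Vmul : left_inverse SO2_one SO2_inv SO2_mul.
Proof.
by move=> A; apply: val_inj; case: A => A /= /andP[/eqP oA _]; apply: mulmx1C.
Qed.

(* (SO2 K * SO2 K)%type inherits the componentwise group structure. *)
HB.instance Definition _ :=
  isGroup.Build SO2 SO2_mulA SO2_1mul SO2_mul1 SO2_Vmul SO2_mulV.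

Definition rot_mx (theta : K) : 'M[K]_2 :=
  \matrix_(i, j) if i == j then cos theta
                 else if i == ord0 then sin theta else - sin theta.

Fact rot_subproof theta : is_SO2 (rot_mx theta).
Proof.
have cs := cos2Dsin2 theta.
apply/andP; split; apply/eqP; last first.
  by rewrite (expand_det_row _ ord0) !big_ord_recl big_ord0 /cofactor !det_mx11
    !mxE /= -[RHS]cs expr0 expr1; ring.
apply/matrixP => i j; rewrite !mxE !big_ord_recl big_ord0 !mxE -cs.
by case: i j => [[|[|//]] ?] [[|[|//]] ?] /=; rewrite ?mulr1n ?mulr0n; ring.
Qed.

Definition rot (theta : K) : SO2 := MkSO2 (rot_subproof theta).

Fact negI_subproof : is_SO2 (- 1%:M).
Proof.
rewrite /is_SO2 linearN /= trmx1 mulNmx mulmxN opprK mulmx1 eqxx /=.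
by rewrite -scaleN1r detZ det1 sqrrN expr1n mulr1.
Qed.

Definition negI : SO2 := MkSO2 negI_subproof.

Definition CN (N : nat) : set SO2 :=
  [set rot (2 * pi * r%:R / N%:R) | r in `I_N].

Definition twisted (kappa r : nat) : set (SO2 * SO2) :=
  [set (rot (2 * pi / (2 ^ kappa)%:R * r%:R * i%:R),
        rot (2 * pi / (2 ^ kappa)%:R * i%:R)) | i in `I_(2 ^ kappa)].

End SpecialOrthogonalGroup.

Arguments CN K N : clear implicits.
Arguments twisted K kappa r : clear implicits.

Section Subgroups.
Local Open Scope group_scope.
Variable G : groupType.

Definition is_subgroup (H : set G) : Prop := group_closed (mem H).

Definition cyc (g : G) : set G :=
  [set h | exists k : nat, h = g ^+ k \/ h = g ^- k].

Definition is_cyclic (H : set G) : Prop := exists g, H = cyc g.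

Definition cyclic_subgroup_of (L H : set G) : Prop :=
  [/\ is_subgroup H, H `<=` L & is_cyclic H].

(* The factors commute elementwise, generate C, and every element of C has a
   unique expression as a product of elements of the factors. *)
Definition internal_dprod (s : nat) (H : 'I_s -> set G) (C : set G) : Prop :=
  [/\ forall i, is_subgroup (H i),
      forall i j x y, i != j -> H i x -> H j y -> commute x y,
      C = [set \prod_(i < s) h i | h in [set h | forall i, H i (h i)]]
    & forall h h' : 'I_s -> G, (forall i, H i (h i)) ->
        (forall i, H i (h' i)) ->
        \prod_(i < s) h i = \prod_(i < s) h' i -> h = h'].

End Subgroups.

Local Open Scope nat_scope.

Definition twist_params (kappa : nat) : set nat :=
  [set r | 1 <= r <= 2 ^ kappa - 1] `\`
  [set l * 2 | l in [set l | 1 <= l <= 2 ^ (kappa - 1) - 1]].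

Definition primary_part (K : realType) (s : nat) (p alpha beta : 'I_s -> nat)
    (i : 'I_s) : set (SO2 K * SO2 K) :=
  CN K (p i ^ alpha i) `*` CN K (p i ^ beta i).

Arguments primary_part K {s} p alpha beta i.

(* There are s.+1 primes, numbered from 0; number 0 is the prime 2. *)
Definition primary_decomposition (K : realType) (n m s : nat)
    (p alpha beta : 'I_s.+1 -> nat) : Prop :=
  [/\ p ord0 = 2, injective p,
      forall i, i != ord0 -> prime (p i) /\ odd (p i),
      1 <= alpha ord0 /\ 1 <= beta ord0
    & internal_dprod (primary_part K p alpha beta) (CN K n `*` CN K m)].

Definition cyclic_decomposition (K : realType) (s : nat)
    (p alpha beta : 'I_s.+1 -> nat) (C : set (SO2 K * SO2 K))
    (A : 'I_s.+1 -> set (SO2 K * SO2 K)) (kappa r : nat) : Prop :=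
  [/\ internal_dprod A C,
      forall i, cyclic_subgroup_of (primary_part K p alpha beta i) (A i),
      1 <= kappa <= minn (alpha ord0) (beta ord0),
      twist_params kappa r
    & A ord0 = twisted K kappa r].

Arguments primary_decomposition K n m {s} p alpha beta.
Arguments cyclic_decomposition {K s} p alpha beta C A kappa r.

(* Indices start at 0, so the four consecutive blocks of indices are
   i < nu, nu <= i < nu + chi, nu + chi <= i < nu + chi + tau and
   nu + chi + tau <= i < nu + chi + tau + psi.  For admissible parameters no
   subtraction is truncated, and the divisions are exact when p i ^ a i divides
   n and p i ^ b i divides m.  The values of k, r, rho and j at indices where
   they do not occur in the exponents are irrelevant. *)
Section Exponents.
Variables (s : nat) (p a b k r rho j : 'I_s -> nat) (nu chi tau psi : nat).

Definition exponentA (n : nat) : nat :=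
  \sum_(i < s | i < nu) r i * p i ^ (a i - k i) * (n %/ p i ^ a i)
  + \sum_(i < s | nu <= i < nu + chi) p i ^ (a i - k i) * (n %/ p i ^ a i)
  + \sum_(i < s | nu + chi <= i < nu + chi + tau) j i * (n %/ p i ^ a i)
  + \sum_(i < s | nu + chi + tau <= i < nu + chi + tau + psi)
       p i ^ (a i - k i) * (n %/ p i ^ a i).

Definition exponentB (m : nat) : nat :=
  \sum_(i < s | i < nu) p i ^ (b i - k i) * (m %/ p i ^ b i)
  + \sum_(i < s | nu <= i < nu + chi)
       rho i * p i ^ (b i - k i + 1) * (m %/ p i ^ b i)
  + \sum_(i < s | nu + chi <= i < nu + chi + tau)
       p i ^ (b i - k i) * (m %/ p i ^ b i)
  + \sum_(i < s | nu + chi + tau <= i < nu + chi + tau + psi)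
       j i * (m %/ p i ^ b i).

Definition admissible : Prop :=
  [/\ nu + chi + tau + psi <= s,
      exists t : 'I_s,
        [/\ t < nu, p t = 2, 1 <= k t <= minn (a t) (b t),
            twist_params (k t) (r t)
          & forall i : 'I_s, i < nu -> i != t ->
              k i <= minn (a i) (b i) /\ r i <= p i ^ k i - 1],
      forall i : 'I_s, nu <= i < nu + chi ->
        1 <= k i <= minn (a i) (b i) /\ rho i <= p i ^ (k i - 1) - 1,
      forall i : 'I_s, nu + chi <= i < nu + chi + tau ->
        a i < k i <= b i /\ j i <= p i ^ a i - 1
    & forall i : 'I_s, nu + chi + tau <= i < nu + chi + tau + psi ->
        b i < k i <= a i /\ j i <= p i ^ b i - 1].

End Exponents.

(* Main.v *)
Require Import Defs.
From mathcomp Require Import all_boot all_order all_algebra all_fingroup.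
From mathcomp Require Import all_classical all_reals all_analysis.
From mathcomp Require Import zify ring lra.

(** Everything is reduced to torsion conditions.  Each element of SO(2) is a
rotation, so the finite group of rotations of order [N] is exactly the set of
solutions of [a ^+ N = 1] ([CN_torsion]), and SO(2) is commutative.  Write [L]
for the product of the two given groups and [q i] for [p i] raised to the
larger of [alpha i] and [beta i].  Comparing the hypothesis on the primary
parts with torsion orders gives [n = \prod_i p i ^ alpha i] and the same for
[m] and [beta] ([primary_factorization]); hence the [i]-th primary part is the
[q i]-torsion of [L] ([primary_partE]).

By the Chinese remainder theorem there are exponents [e i] congruent to 1 modulo
[q i] and to 0 modulo the other [q j].  In a commutative group killed by the
product of the [q i], the map [g |-> g ^+ e i] is the projection on the
[q i]-torsion.  So any subgroup is the internal direct product of its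
[q i]-torsion parts ([torsion_dprod]), these are the only possible factors
([internal_dprod_torsion]), and a cyclic subgroup has cyclic parts
([cyc_torsion]).  Conversely, generators of the parts multiply to a generator of
the whole ([internal_dprod_cyc]).

It remains to normalise a generator [(x ^+ u, y ^+ v)] of one part, where [x]
has order [p ^ a] and [y] has order [p ^ b].  Let [p ^ c] and [p ^ d] be the
orders of its components.  Raising it to a power prime to [p], which generates
the same group, turns the component of larger order into [x ^+ (p ^ (a - c))] or
[y ^+ (p ^ (b - d))]; the other component is then restricted only by its order.
The four ranges of indices in the exponents are the four cases: [c <= d] or
[d < c], and the larger of the two does or does not exceed the exponent
available on the other side ([block_normal_form]).  For the prime 2, some power
of the generator is [(-I, -I)], whose components both have order 2; this forces
[c = d] and makes the parameter [r] odd ([dyadic_normal_form]), which is the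
announced shape of the first factor.  Its parameters can be read off the group,
because the second component has order [2 ^ kappa] and a single element of the
group has the standard rotation as second component ([twisted_inj]).

The primes are finally sorted by their case ([sorting_perm]), and the two
exponents become sums over all primes ([exponentA_blocks],
[exponentB_blocks]). *)

Set Implicit Arguments.
Unset Strict Implicit.
Unset Printing Implicit Defensive.

Import Order.TTheory GRing.Theory Num.Theory.

(* The bare name would denote the rotation of sequences. *)
Local Notation rot := Defs.rot.

(** * Chinese remainders for families *)

Lemma coprime_prod (I : Type) (r : seq I) (P : pred I) (F : I -> nat) m :
  (forall i, P i -> coprime m (F i)) -> coprime m (\prod_(i <- r | P i) F i).
Proof.
move=> coF; elim/big_rec: _ => [|i n Pi co_n]; first exact: coprimen1.
by rewrite coprimeMr coF.
Qed.

Section Congruences.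
Variables (s : nat) (q : 'I_s -> nat).
Hypothesis co_q : forall i j, i != j -> coprime (q i) (q j).

Lemma chinese_family (c : 'I_s -> nat) :
  exists k, forall i, k = c i %[mod q i].
Proof.
pose M j := \prod_(i < s | i != j) q i.
have coM j : coprime (q j) (M j).
  by apply/coprime_prod => i ij; apply: co_q; rewrite eq_sym.
exists (\sum_j c j * chinese (q j) (M j) 1 0) => i.
rewrite (bigD1 i) //= -modnDmr.
have -> : (\sum_(j | j != i) c j * chinese (q j) (M j) 1 0) %% q i = 0.
  apply/eqP/dvdn_sum => j ji; apply: dvdn_mull.
  have /eqP := chinese_modr (coM j) 1 0; rewrite mod0n => /eqP/eqP.
  by apply: dvdn_trans; rewrite /M (bigD1 i) //= 1?eq_sym // dvdn_mulr.
by rewrite addn0 -modnMmr chinese_modl // modnMmr muln1.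
Qed.

Lemma eq_mod_prod a b :
  (forall i, a = b %[mod q i]) -> a = b %[mod \prod_(i < s) q i].
Proof.
elim: s q co_q => [|n IHn] Q coQ ab; first by rewrite big_ord0 !modn1.
rewrite big_ord_recl; apply/eqP; rewrite chinese_remainder.
  rewrite (ab ord0) eqxx /=; apply/eqP/IHn => // i j ij; apply: coQ.
  by rewrite (inj_eq lift_inj).
by apply/coprime_prod => i _; apply: coQ.
Qed.

(** Exponents of the projections on the torsion parts: they behave like the
primitive idempotents of the product of the rings of integers modulo [q i]. *)
Lemma idempotent_exponents : exists e : 'I_s -> nat,
  forall j i, e j = (i == j) %[mod q i].
Proof.
exact: (fin_all_exists (fun j => chinese_family (fun i => i == j))).
Qed.

End Congruences.

(** * Cyclic subgroups *)

Section CyclicSets.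
Local Open Scope group_scope.
Variable G : groupType.
Implicit Types (g h : G) (H : set G).

Lemma eq_expg_mod g N a b : g ^+ N = 1 -> a = b %[mod N] -> g ^+ a = g ^+ b.
Proof.
move=> gN; have red c : g ^+ c = g ^+ (c %% N).
  by rewrite [in LHS](divn_eq c N) expgnDr mulnC expgnA gN expg1n mul1g.
by move=> ab; rewrite red ab -red.
Qed.

Lemma is_subgroupP H :
  is_subgroup H <-> H 1 /\ forall x y, H x -> H y -> H (x * y^-1).
Proof.
rewrite /is_subgroup /group_closed /divg_closed; split.
  case=> /set_mem H1 HF; split => // x y /mem_set Hx /mem_set Hy.
  exact: set_mem (HF _ _ Hx Hy).
case=> H1 HF; split; first exact: mem_set.
by move=> x y /set_mem Hx /set_mem Hy; apply: mem_set; apply: HF.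
Qed.

Lemma subgroupM H x y : is_subgroup H -> H x -> H y -> H (x * y).
Proof.
move=> /is_subgroupP[H1 HF] Hx Hy; rewrite -[y]invgK.
by apply: (HF _ _ Hx); rewrite -[y^-1]mul1g; apply: HF.
Qed.

Lemma subgroupX H x k : is_subgroup H -> H x -> H (x ^+ k).
Proof.
move=> sH Hx; elim: k => [|k IHk]; first by case/is_subgroupP: sH.
by rewrite expgS; apply: subgroupM.
Qed.

Lemma cyc_id g : cyc g g. Proof. by exists 1%N; left. Qed.

(** With finite order, inverses are natural powers, and the second family in
[cyc] may be ignored. *)
Lemma cycP g N : 0 < N -> g ^+ N = 1 ->
  forall h, cyc g h <-> exists k, h = g ^+ k.
Proof.
move=> N0 gN h; split; last by case=> k ->; exists k; left.
case=> k [->|->]; first by exists k.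
exists (k * N.-1)%N; apply: (mulgI (g ^+ k)).
by rewrite mulgV -expgnDr -mulnS prednK // mulnC expgnA gN expg1n.
Qed.

(** [cyc] is a union of two families of natural powers, so a quotient of two
elements has to be rewritten as a power or an inverse power, depending on which
exponent is larger. *)
Lemma cyc_is_subgroup g : is_subgroup (cyc g).
Proof.
have mix a b : cyc g (g ^+ a * g ^- b) /\ cyc g (g ^- a * g ^+ b).
  case: (leqP a b) => ab; split.
  - exists (b - a)%N; right.
    by rewrite expgnFr // invgF.
  - exists (b - a)%N; left; rewrite expgnFr //.
    exact/commute_sym/commuteV/commuteX2/commute_refl.
  - by exists (a - b)%N; left; rewrite expgnFr // ltnW.
  - exists (a - b)%N; right; rewrite expgnFr ?(ltnW ab) // invgF.
    exact/commute_sym/commuteV/commuteX2/commute_refl.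
apply/is_subgroupP; split; first by exists 0; left.
move=> _ _ [a [->|->]] [b [->|->]].
- by have [] := mix a b.
- by exists (a + b)%N; left; rewrite invgK expgnDr.
- by exists (b + a)%N; right; rewrite expgnDr invgM.
- by rewrite invgK; have [] := mix a b.
Qed.

Lemma cyc_sub H g : is_subgroup H -> H g -> (cyc g `<=` H)%classic.
Proof.
move=> sH Hg _ [k [->|->]]; first exact: subgroupX.
have /is_subgroupP[H1 HF] := sH.
by rewrite -[_^-1]mul1g; apply: HF => //; apply: subgroupX.
Qed.

Lemma cyc_eq g h : cyc g h -> cyc h g -> cyc g = cyc h.
Proof.
by move=> gh hg; apply/seteqP; split; apply: cyc_sub => //;
  apply: cyc_is_subgroup.
Qed.

Lemma cyc_expg_coprime g N w :
  0 < N -> g ^+ N = 1 -> coprime w N -> cyc (g ^+ w) = cyc g.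
Proof.
move=> N0 gN cwN; apply: cyc_eq; last by exists w; left.
(* The exponent inverts w modulo N. *)
exists (chinese w N 0 1 %/ w)%N; left; rewrite -expgnA mulnC divnK.
  by rewrite -[LHS]expg1; apply: (eq_expg_mod gN); rewrite chinese_modr.
by rewrite /dvdn chinese_modl // mod0n.
Qed.

End CyclicSets.

(** * Decomposition by coprime torsion *)

Lemma internal_dprod_factor (G : groupType) (s : nat) (A : 'I_s -> set G)
    (C : set G) i : internal_dprod A C -> (A i `<=` C)%classic.
Proof.
move=> [sA _ -> _] g Ag; exists (fun j => if j == i then g else 1%g) => [j|].
  by case: eqP => [->//|_]; case/is_subgroupP: (sA j).
by rewrite (big_only1 i) ?eqxx // => j /negPf ->.
Qed.

Section CoprimeTorsion.
Local Open Scope group_scope.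
Variable G : groupType.
Hypothesis commG : forall x y : G, commute x y.
Implicit Types (g h : G) (H C : set G).

Definition torsion N : set G := [set g | g ^+ N = 1]%classic.

Lemma torsion_subgroup N : is_subgroup (torsion N).
Proof.
apply/is_subgroupP; split=> [|x y]; rewrite /torsion /= ?expg1n // => xN yN.
by rewrite expgMn // expVgn xN yN mulgV.
Qed.

Lemma subgroupI H C : is_subgroup H -> is_subgroup C ->
  is_subgroup (H `&` C)%classic.
Proof.
move=> /is_subgroupP[H1 HF] /is_subgroupP[C1 CF]; apply/is_subgroupP.
by split=> // x y [Hx Cx] [Hy Cy]; split; [apply: HF | apply: CF].
Qed.

Lemma prodgX (I : Type) (r : seq I) (F : I -> G) k :
  (\prod_(i <- r) F i) ^+ k = \prod_(i <- r) F i ^+ k.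
Proof.
apply: (big_morph (fun x : G => x ^+ k)); last exact: expg1n.
by move=> x y; rewrite expgMn.
Qed.

Lemma subgroup_prod H (I : Type) (r : seq I) (F : I -> G) :
  is_subgroup H -> (forall i, H (F i)) -> H (\prod_(i <- r) F i).
Proof.
move=> sH HF; elim/big_rec: _ => [|i x _ Hx]; first by case/is_subgroupP: sH.
exact: subgroupM.
Qed.

Variables (s : nat) (q : 'I_s -> nat).
Hypothesis q_gt0 : forall i, 0 < q i.
Hypothesis co_q : forall i j, i != j -> coprime (q i) (q j).

Lemma prod_expg_congr (h : 'I_s -> G) (k : nat) (c : 'I_s -> nat) :
    (forall i, torsion (q i) (h i)) -> (forall i, k = c i %[mod q i]) ->
  (\prod_(i < s) h i) ^+ k = \prod_(i < s) h i ^+ c i.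
Proof.
by move=> tor kc; rewrite prodgX; apply: eq_bigr => i _;
  apply: eq_expg_mod (tor i) (kc i).
Qed.

(** A power that is idempotent modulo the [q j] projects a product of torsion
elements on one factor; uniqueness of decompositions follows. *)
Lemma prod_expg_idem (h : 'I_s -> G) (k : nat) (i : 'I_s) :
    (forall j, torsion (q j) (h j)) -> (forall j, k = (j == i) %[mod q j]) ->
  (\prod_(j < s) h j) ^+ k = h i.
Proof.
move=> tor ki; rewrite (prod_expg_congr tor ki) (big_only1 i) //.
  by rewrite eqxx expg1.
by move=> j /negPf -> _; rewrite expg0.
Qed.

Lemma idem_torsion g (i : 'I_s) k :
    g ^+ (\prod_(j < s) q j)%N = 1 -> (forall j, k = (j == i) %[mod q j]) ->
  torsion (q i) (g ^+ k).
Proof.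
move=> gN ki; rewrite /torsion /= -expgnA -(expg0 g).
apply: (eq_expg_mod gN); apply: eq_mod_prod => // j.
rewrite -modnMml ki; case: eqP => [->|_]; first by rewrite modnMml mul1n modnn mod0n.
by rewrite mod0n mul0n mod0n.
Qed.

(** The component of [g] in the [i]-th factor is its power by the [i]-th
idempotent, and the idempotents add up to 1 modulo the product of the [q i]. *)
Lemma torsion_dprod C :
    is_subgroup C -> (forall g, C g -> g ^+ (\prod_(i < s) q i)%N = 1) ->
  internal_dprod (fun i => C `&` torsion (q i))%classic C.
Proof.
move=> sC CN; have [e eP] := idempotent_exponents co_q.
split=> //.
- by move=> i; apply: subgroupI => //; apply: torsion_subgroup.
- apply/seteqP; split=> [g Cg | _ [h hC <-]]; last first.
    by apply: subgroup_prod => // i; case: (hC i).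
  exists (fun i => g ^+ e i) => [i|].
    split; first exact: subgroupX.
    by apply: idem_torsion (CN _ Cg) (eP i).
  rewrite prodgXr -[RHS]expg1; apply: (eq_expg_mod (CN _ Cg)).
  apply: eq_mod_prod => // i; rewrite (bigD1 i) //= -modnDmr.
  have -> : (\sum_(j < s | j != i) e j) %% q i = 0.
    apply/eqP/dvdn_sum => j /negPf ji.
    by rewrite /dvdn eP [i == j]eq_sym ji mod0n.
  by rewrite addn0 eP eqxx.
- move=> h h' hC h'C eq_hh'; apply/funext => i.
  rewrite -(@prod_expg_idem h (e i) i) => [|j|//]; last by case: (hC j).
  by rewrite eq_hh' (@prod_expg_idem h' (e i) i) // => j; case: (h'C j).
Qed.

(** The [q i]-torsion elements of [C] are fixed by the [i]-th projection, which
sends [C] into the factor [A i]; so the factors are determined by [C]. *)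
Lemma internal_dprod_torsion C (A : 'I_s -> set G) :
    internal_dprod A C -> (forall i, A i `<=` torsion (q i))%classic ->
  forall i, A i = (C `&` torsion (q i))%classic.
Proof.
move=> AC At i; apply/seteqP; split=> g.
  by move=> Ag; split; [apply: internal_dprod_factor AC _ Ag | apply: At].
have [_ _ -> _] := AC.
move=> -[[h Ah <-] tor].
have [e eP] := idempotent_exponents co_q.
have <- : (\prod_(j < s) h j) ^+ e i = \prod_(j < s) h j.
  by rewrite (eq_expg_mod tor (eP i i)) eqxx expg1.
rewrite (@prod_expg_idem h (e i) i) //.
by move=> j; apply: At.
Qed.

(** The projection on the [q i]-torsion maps a generator to a generator. *)
Lemma cyc_torsion g i : g ^+ (\prod_(i < s) q i)%N = 1 ->
  exists k, (cyc g `&` torsion (q i))%classic = cyc (g ^+ k).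
Proof.
move=> gN; have [e eP] := idempotent_exponents co_q; exists (e i).
have N0 : (0 < \prod_(j < s) q j)%N by apply: prodn_gt0.
apply/seteqP; split=> [x [/(cycP N0 gN)[k ->] tor]|].
  exists k; left; rewrite -expgnA mulnC expgnA.
  by rewrite (eq_expg_mod tor (eP i i)) eqxx expg1.
apply: cyc_sub.
  by apply: subgroupI; [apply: cyc_is_subgroup | apply: torsion_subgroup].
split; first by exists (e i); left.
by apply: idem_torsion (eP i).
Qed.

(** A family of powers of the generators, with exponents [c i], is a single power
of their product: solve [k = c i] modulo every [q i]. *)
Lemma internal_dprod_cyc C (A : 'I_s -> set G) (g : 'I_s -> G) :
    internal_dprod A C -> (forall i, A i = cyc (g i)) ->
    (forall i, torsion (q i) (g i)) ->
  C = cyc (\prod_(i < s) g i).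
Proof.
move=> [_ _ -> _] Ag tor; apply/seteqP; split=> [_ [h Ah <-]|].
  have /fin_all_exists[c hc] i : exists k, h i = g i ^+ k.
    by apply/(cycP (q_gt0 i) (tor i)); rewrite -Ag.
  have [k kc] := chinese_family co_q c; exists k; left.
  by rewrite (prod_expg_congr tor kc); apply: eq_bigr => i _.
have N0 : (0 < \prod_(j < s) q j)%N by apply: prodn_gt0.
have gN : (\prod_(i < s) g i) ^+ (\prod_(i < s) q i)%N = 1.
  rewrite (@prod_expg_congr g _ (fun => 0)) // => [|i].
    by rewrite big1 // => i _; rewrite expg0.
  by rewrite (bigD1 i) //= modnMr mod0n.
move=> _ /(cycP N0 gN)[k ->]; exists (fun i => g i ^+ k).
  by move=> i; rewrite Ag; exists k; left.
by rewrite prodgX.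
Qed.

End CoprimeTorsion.

(** * Normal forms of cyclic subgroups of prime power order *)

Section Order.
Local Open Scope group_scope.

Definition has_order (G : groupType) (x : G) (N : nat) : Prop :=
  forall k, x ^+ k = 1 <-> N %| k.

Lemma pairX (G H : groupType) (x : G) (y : H) k :
  (x, y) ^+ k = (x ^+ k, y ^+ k) :> G * H.
Proof. by elim: k => // k IHk; rewrite !expgS IHk. Qed.

Variables (G : groupType) (x : G) (N : nat).
Hypotheses (N_gt0 : 0 < N) (ox : has_order x N).

Lemma has_order_id : x ^+ N = 1.
Proof. exact/ox. Qed.

Lemma has_order_div d : d %| N -> has_order (x ^+ (N %/ d)) d.
Proof.
move=> dN k; rewrite -expgnA (ox _) -{1}(divnK dN).
have d0 : 0 < d by apply: dvdn_gt0 dN.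
by rewrite dvdn_pmul2l // divn_gt0 //; apply: dvdn_leq.
Qed.

(** An element of [d]-torsion in a cyclic group of order [N] is a power of the
[N %/ d]-th power of the generator, with an exponent that counts modulo [d]. *)
Lemma expg_torsion d u : d %| N -> (x ^+ u) ^+ d = 1 ->
  exists2 r, r < d & x ^+ u = x ^+ (r * (N %/ d))%N.
Proof.
move=> dN; rewrite -expgnA => /ox; rewrite -{1}(divnK dN).
have d0 := dvdn_gt0 N_gt0 dN; rewrite dvdn_pmul2r // => /dvdnP[t ->].
exists (t %% d); first by rewrite ltn_pmod.
rewrite !(mulnC _ (N %/ d)) !expgnA.
by apply: (@eq_expg_mod _ _ d); rewrite ?modn_mod //; apply/has_order_div.
Qed.

End Order.

Section PrimePower.
Local Open Scope group_scope.

(** Here [p ^ c] is the order of [x ^+ u]: writing [u] as [u' * p ^ (a - c)] with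
[u'] prime to [p], the exponent [w] is an inverse of [u'] modulo [p ^ a]. *)
Lemma expg_prime_power (G : groupType) (x : G) p a u :
    prime p -> has_order x (p ^ a)%N ->
  exists c w, [/\ c <= a, coprime w p, (x ^+ u) ^+ w = x ^+ (p ^ (a - c))%N
                & (x ^+ u) ^+ (p ^ c)%N = 1].
Proof.
move=> pr_p ox; have p0 := prime_gt0 pr_p.
have [/ox xu1|ndv] := boolP (p ^ a %| u)%N.
  exists 0, 1%N; split=> //; first exact: coprime1n.
  by rewrite expg1 subn0 xu1; apply/esym/ox.
have u0 : (0 < u)%N by case: (u) ndv; rewrite ?dvdn0.
have [u' co_u' eu] := pfactor_coprime pr_p u0.
set e := logn p u in eu.
have ea : (e < a)%N.
  rewrite ltnNge; apply: contra ndv => ae; rewrite eu.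
  by apply: dvdn_mull; apply: dvdn_exp2l.
have co_pa : coprime u' (p ^ a) by rewrite coprimeXr // coprime_sym.
(* The exponent inverts u' modulo the order of x. *)
exists (a - e)%N, (chinese u' (p ^ a) 0 1 %/ u'); rewrite leq_subr subKn ?(ltnW ea) //.
have u'dv : (u' %| chinese u' (p ^ a) 0 1)%N.
  by rewrite /dvdn chinese_modl // mod0n.
have inv : (chinese u' (p ^ a) 0 1 = 1 %[mod p ^ a])%N by rewrite chinese_modr.
split=> //.
- have : coprime (chinese u' (p ^ a) 0 1) p.
    rewrite -(@coprime_pexpr a) ?(leq_ltn_trans _ ea) //.
    by rewrite -coprime_modl inv coprime_modl coprime1n.
  by apply: coprime_dvdl; apply/dvdnP; exists u'; rewrite mulnC divnK.
- rewrite -expgnA eu -mulnA mulnCA (mulnC u') divnK // mulnC mulnC expgnA.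
  rewrite -[RHS]expg1; apply: (@eq_expg_mod _ _ (p ^ a)) => //.
  by rewrite -expgnA mulnC expgnA (has_order_id ox) expg1n.
- rewrite -expgnA; apply/ox; rewrite eu -mulnA -expnD subnKC ?(ltnW ea) //.
  exact: dvdn_mull.
Qed.

Variables (G H : groupType) (x : G) (y : H) (p a b : nat).
Hypotheses (pr_p : prime p).
Hypotheses (ox : has_order x (p ^ a)%N) (oy : has_order y (p ^ b)%N).

Let p_gt0 : 0 < p. Proof. exact: prime_gt0. Qed.
Let pX_gt0 k : 0 < p ^ k. Proof. by rewrite expn_gt0 p_gt0. Qed.

Lemma cyc_pair_coprime u v w : coprime w p ->
  cyc (x ^+ u, y ^+ v) = cyc (x ^+ u ^+ w, y ^+ v ^+ w) :> set (G * H).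
Proof.
move=> co_w; rewrite -pairX.
apply/esym/(@cyc_expg_coprime _ _ (p ^ (a + b))) => //; last exact: coprimeXr.
rewrite pairX -!expgnA; congr (_, _).
  by apply/ox; apply/dvdn_mull/dvdn_exp2l/leq_addr.
by apply/oy; apply/dvdn_mull/dvdn_exp2l/leq_addl.
Qed.

(** The case [ty] is 0, 1, 2 or 3 for an index in the range of length [nu],
[chi], [tau] or [psi]; [t] stands for the parameter [r], [rho] or [j] that
occurs in this range, as no two of them occur together. *)
Definition block_expA (ty k t : nat) :=
  match ty with 0 => t * p ^ (a - k) | 2 => t | _ => p ^ (a - k) end%N.

Definition block_expB (ty k t : nat) :=
  match ty with
  | 0 => p ^ (b - k) | 1 => t * p ^ (b - k + 1) | 2 => p ^ (b - k) | _ => t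
  end%N.

Definition block_restr (ty k t : nat) : Prop :=
  match ty with
  | 0 => k <= minn a b /\ t <= p ^ k - 1
  | 1 => 1 <= k <= minn a b /\ t <= p ^ (k - 1) - 1
  | 2 => a < k <= b /\ t <= p ^ a - 1
  | _ => b < k <= a /\ t <= p ^ b - 1
  end%N.

Lemma expg_ppower_torsion (K : groupType) (z : K) c k u :
    has_order z (p ^ c)%N -> k <= c -> (z ^+ u) ^+ (p ^ k)%N = 1 ->
  exists2 r, r <= p ^ k - 1 & z ^+ u = z ^+ (r * p ^ (c - k))%N.
Proof.
move=> oz kc zk; have := expg_torsion (pX_gt0 c) oz (dvdn_exp2l p kc) zk.
by case=> r rk ->; exists r; [rewrite leq_subRL ?add1n | rewrite expnB].
Qed.

Lemma torsion_mono (K : groupType) (z : K) c d w :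
  c <= d -> z ^+ (p ^ c)%N = 1 -> (z ^+ w) ^+ (p ^ d)%N = 1.
Proof.
move=> cd zc; rewrite -expgnA mulnC -(subnKC cd) expnD -!mulnA expgnA zc.
by rewrite expg1n.
Qed.

(** The component of larger order is normalised, and it is the second one when the
orders agree.  The other component is killed by the order [p ^ k] of the first,
and by [p ^ (k - 1)] in case 1, where its order is strictly smaller; hence the
bounds on [t].  If [p ^ k] exceeds the order of the ambient group of that other
component (cases 2 and 3), the only bound left is reduction modulo this
order. *)
Lemma block_normal_form u v : exists ty k t,
  [/\ ty < 4, block_restr ty k t
    & cyc (x ^+ u, y ^+ v) =
      cyc (x ^+ block_expA ty k t, y ^+ block_expB ty k t) :> set (G * H)].
Proof.
have [c [w1 [ca cow1 xw xc]]] := expg_prime_power u pr_p ox.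
have [d [w2 [db cow2 yw yd]]] := expg_prime_power v pr_p oy.
case: (leqP c d) => cd.
  have tor : (x ^+ u ^+ w2) ^+ (p ^ d)%N = 1 by apply: torsion_mono xc.
  rewrite (cyc_pair_coprime u v cow2) yw -(expgnA x); rewrite -(expgnA x) in tor.
  case: (leqP d a) => da.
    have [r rd ->] := expg_ppower_torsion ox da tor.
    by exists 0, d, r; rewrite /block_restr leq_min da db.
  exists 2, d, ((u * w2) %% p ^ a)%N; split=> //.
    by rewrite /block_restr da db leq_subRL ?add1n ?ltn_pmod.
  congr (cyc (_, _)).
  by apply: (eq_expg_mod (has_order_id ox)); rewrite modn_mod.
rewrite (cyc_pair_coprime u v cow1) xw -(expgnA y).
case: (leqP c b) => cb.
  have c0 : 0 < c by apply: leq_trans cd.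
  have tor : (y ^+ (v * w1)%N) ^+ (p ^ (c - 1))%N = 1.
    by rewrite expgnA; apply: torsion_mono yd; rewrite subn1 -ltnS prednK.
  have [|r rd ->] := expg_ppower_torsion oy _ tor.
    by rewrite (leq_trans _ cb) // leq_subr.
  exists 1%N, c, r; rewrite /block_restr leq_min ca cb c0; split=> //.
  by have -> : (b - (c - 1) = b - c + 1)%N by lia.
exists 3, c, ((v * w1) %% p ^ b)%N; split=> //.
  by rewrite /block_restr cb ca leq_subRL ?add1n ?ltn_pmod.
congr (cyc (_, _)).
by apply: (eq_expg_mod (has_order_id oy)); rewrite modn_mod.
Qed.

End PrimePower.

Section Dyadic.
Local Open Scope group_scope.

(** The set of [twist_params] excludes exactly the even values. *)
Lemma odd_twist_params k r : 0 < k -> odd r -> r <= 2 ^ k - 1 ->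
  twist_params k r.
Proof.
move=> k0 r_odd rk; split=> /=; first by rewrite rk andbT; case: (r) r_odd.
by case=> l _ rE; move: r_odd; rewrite -rE oddM andbF.
Qed.

(** An exponent [l] for which the power of an element of order [2 ^ c] has order 2
is a multiple of [2 ^ (c - 1)].  So it kills any [y] whose order is smaller. *)
Lemma dyadic_order_le (G H : groupType) (x : G) (y : H) a u c d w l :
    has_order x (2 ^ a)%N -> c <= a ->
    (x ^+ u) ^+ w = x ^+ (2 ^ (a - c))%N -> y ^+ (2 ^ d)%N = 1 ->
    ((x ^+ u) ^+ l) ^+ 2 = 1 -> y ^+ l <> 1 -> c <= d.
Proof.
move=> ox ca xw yd xl yl; rewrite leqNgt; apply/negP => dc; apply: yl.
have : (x ^+ (2 ^ (a - c))%N) ^+ (l * 2)%N = 1.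
  by rewrite -xw expgnAC expgnA xl expg1n.
rewrite -expgnA => /ox; rewrite -[X in (2 ^ X)%N](subnK ca) expnD.
rewrite dvdn_pmul2l ?expn_gt0 // -(prednK (leq_ltn_trans (leq0n d) dc)).
rewrite expnSr dvdn_pmul2r // => cl.
have /dvdnP[m ->] : (2 ^ d %| l)%N.
  by apply: dvdn_trans cl; apply: dvdn_exp2l; rewrite -ltnS (ltn_predK dc).
by rewrite mulnC expgnA yd expg1n.
Qed.

(** The same exponent takes the two components to [e] and [f], both of order 2, so
the components have the same order [2 ^ c].  An even [r] would give the first
component a smaller order. *)
Lemma dyadic_normal_form (G H : groupType) (x : G) (y : H) a b u v e f :
    has_order x (2 ^ a)%N -> has_order y (2 ^ b)%N ->
    e <> 1 -> f <> 1 -> e ^+ 2 = 1 -> f ^+ 2 = 1 ->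
    cyc (x ^+ u, y ^+ v) (e, f) ->
  exists k r, [/\ 1 <= k <= minn a b, twist_params k r
    & cyc (x ^+ u, y ^+ v) =
      cyc (x ^+ (r * 2 ^ (a - k))%N, y ^+ (2 ^ (b - k))%N) :> set (G * H)].
Proof.
move=> ox oy e1 f1 e2 f2.
have g2 : (x ^+ u, y ^+ v) ^+ (2 ^ (a + b))%N = 1.
  rewrite pairX -!expgnA; congr (_, _).
    by apply/ox; apply/dvdn_mull/dvdn_exp2l/leq_addr.
  by apply/oy; apply/dvdn_mull/dvdn_exp2l/leq_addl.
case/(cycP _ g2) => [|l]; first by rewrite expn_gt0.
rewrite pairX => -[eE fE].
have [c [w1 [ca cow1 xw xc]]] := @expg_prime_power _ x 2 a u isT ox.
have [d [w2 [db cow2 yw yd]]] := @expg_prime_power _ y 2 b v isT oy.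
have cd : c <= d.
  by apply: (dyadic_order_le (l := l) ox ca xw yd); rewrite -?eE -?fE.
have dc : d <= c.
  by apply: (dyadic_order_le (l := l) oy db yw xc); rewrite -?eE -?fE.
have {dc cd} cd : c = d by apply/eqP; rewrite eqn_leq cd dc.
subst d; have c0 : 0 < c.
  rewrite lt0n; apply/eqP => c0; apply: e1; move: xc.
  by rewrite eE c0 expn0 expg1 => ->; rewrite expg1n.
have tor : (x ^+ (u * w2)%N) ^+ (2 ^ c)%N = 1.
  by rewrite expgnA; apply: torsion_mono xc.
have [r rc xr] := @expg_ppower_torsion 2 isT _ x a c _ ox ca tor.
exists c, r; split; first by rewrite leq_min ca db c0.
  apply: odd_twist_params => //; apply/negPn/negP => r_even.
  have a0 := leq_trans c0 ca.
  have : x ^+ (u * w2 * 2 ^ (c - 1))%N = 1.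
    rewrite expgnA xr -expgnA; apply/ox.
    have /dvdnP[r' ->] : (2 %| r)%N by rewrite dvdn2.
    rewrite -mulnA -mulnA dvdn_mull // -expnD -expnS dvdn_exp2l //; lia.
  move=> /ox; rewrite mulnAC Gauss_dvdl ?coprimeXl 1?coprime_sym // => dv.
  have : x ^+ (2 ^ (a - c) * 2 ^ (c - 1))%N = 1.
    by move/ox: dv => dv; rewrite expgnA -xw expgnAC -(expgnA x) dv expg1n.
  move/ox; rewrite -expnD dvdn_Pexp2l //; lia.
by rewrite (@cyc_pair_coprime _ _ _ _ 2 a b isT ox oy u v w2 cow2) // yw -expgnA xr.
Qed.

End Dyadic.

(** * Sorting the primes by case, and the exponents as sums *)

Section Blocks.

(** The permutation sorts the values of [ty], so that for every [c] the indices of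
the values below [c] come first. *)
Lemma sorting_perm n (ty : 'I_n -> nat) :
  exists sigma : {perm 'I_n}, forall c (i : 'I_n),
    (i < #|[pred j | ty j < c]|) = (ty (sigma i) < c).
Proof.
pose l := sort (relpre ty leq) (enum 'I_n).
have perm_l : perm_eq l (ord_tuple n) by rewrite perm_sort val_ord_tuple.
have size_l : size l = n by rewrite (perm_size perm_l) size_tuple.
have sorted_l : sorted leq (map ty l).
  by rewrite sorted_map; apply: sort_sorted => i j; apply: leq_total.
have [sigma lE] := tuple_permP perm_l; exists sigma => c i.
have ln : nth 0 (map ty l) i = ty (sigma i).
  rewrite (nth_map i) ?size_l // lE -tnth_nth tnth_mktuple.
  by rewrite tnth_ord_tuple.
have -> : #|[pred j | ty j < c]| = count (ltn^~ c) (map ty l).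
  rewrite count_map (seq.permP (permEl (perm_sort _ _))) cardE.
  by rewrite [enum [pred j | _]]/enum_mem size_filter enumT.
rewrite -ln; apply/idP/idP => [|lt_c].
  exact: (@nth_count_lt _ nat).
rewrite ltnNge; apply/negP => le_i.
have := @nth_count_ge _ nat c 0 (map ty l) i sorted_l.
by rewrite size_map size_l ltn_ord le_i leEnat leqNgt lt_c => /(_ isT).
Qed.

End Blocks.

Section BlockSums.
Variables (s : nat) (p a b k t ty : 'I_s -> nat) (nu chi tau psi : nat).
Hypothesis ty_lt4 : forall i, ty i < 4.
Hypothesis nuE : forall i : 'I_s, (i < nu) = (ty i < 1).
Hypothesis chiE : forall i : 'I_s, (i < nu + chi) = (ty i < 2).
Hypothesis tauE : forall i : 'I_s, (i < nu + chi + tau) = (ty i < 3).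
Hypothesis psiE : forall i : 'I_s, (i < nu + chi + tau + psi) = (ty i < 4).

Lemma exponentA_blocks n :
  exponentA p a k t t nu chi tau psi n =
  \sum_(i < s) block_expA (p i) (a i) (ty i) (k i) (t i) * (n %/ p i ^ a i).
Proof.
rewrite /exponentA [X in X + _ + _ + _]big_mkcond [X in _ + X + _ + _]big_mkcond.
rewrite [X in _ + X + _ = _]big_mkcond [X in _ + X = _]big_mkcond -!big_split.
apply: eq_bigr => i _ /=.
rewrite !(leqNgt _ (nat_of_ord i)) nuE chiE tauE psiE.
by case: (ty i) (ty_lt4 i) => [|[|[|[|//]]]] _ /=; rewrite ?addn0 ?add0n.
Qed.

Lemma exponentB_blocks m :
  exponentB p b k t t nu chi tau psi m =
  \sum_(i < s) block_expB (p i) (b i) (ty i) (k i) (t i) * (m %/ p i ^ b i).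
Proof.
rewrite /exponentB [X in X + _ + _ + _]big_mkcond [X in _ + X + _ + _]big_mkcond.
rewrite [X in _ + X + _ = _]big_mkcond [X in _ + X = _]big_mkcond -!big_split.
apply: eq_bigr => i _ /=.
rewrite !(leqNgt _ (nat_of_ord i)) nuE chiE tauE psiE.
by case: (ty i) (ty_lt4 i) => [|[|[|[|//]]]] _ /=; rewrite ?addn0 ?add0n.
Qed.

Lemma admissible_blocks (i2 : 'I_s) :
    nu + chi + tau + psi <= s ->
    ty i2 = 0 -> p i2 = 2 -> 1 <= k i2 <= minn (a i2) (b i2) ->
    twist_params (k i2) (t i2) ->
    (forall i, block_restr (p i) (a i) (b i) (ty i) (k i) (t i)) ->
  admissible p a b k t t t nu chi tau psi.
Proof.
move=> le_s ty2 p2 k2 t2 restr.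
have restr_ty c i : c <= ty i < c.+1 ->
    block_restr (p i) (a i) (b i) c (k i) (t i).
  by rewrite ltnS -eqn_leq => /eqP ->.
split=> //.
- exists i2; split; rewrite ?nuE ?ty2 // => i.
  by rewrite nuE => ci _; apply: (restr_ty 0).
- by move=> i; rewrite leqNgt nuE chiE -leqNgt => /restr_ty.
- by move=> i; rewrite leqNgt chiE tauE -leqNgt => /restr_ty.
- by move=> i; rewrite leqNgt tauE psiE -leqNgt => /restr_ty.
Qed.

End BlockSums.

(** * Prime factorizations over a common family of primes *)

Section Factorization.

(** The primes in [l] that do not divide [n] contribute factors 1, which allows a
common list of primes for [n] and [m]. *)
Lemma prod_logn (l : seq nat) n : 0 < n -> uniq l ->
  {subset primes n <= l} -> {in l, forall p, prime p} ->
  n = \prod_(p <- l) p ^ logn p n.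
Proof.
move=> n0 ul sub pl; rewrite [LHS]prod_prime_decomp // prime_decompE big_map /=.
rewrite [RHS](bigID (mem (primes n))) /= [X in _ * X]big1_seq ?muln1.
  rewrite -[RHS]big_filter; apply: perm_big; apply: uniq_perm.
  - exact: primes_uniq.
  - exact: filter_uniq.
  - move=> p; rewrite mem_filter; apply/idP/andP => [pn|[] //].
    by split=> //; apply: sub.
move=> p /andP[pn _]; suff -> : logn p n = 0 by [].
by apply/eqP; rewrite -leqn0 leqNgt logn_gt0.
Qed.

Lemma prime_family_exists n m : 0 < n -> 0 < m -> ~~ odd n -> ~~ odd m ->
  exists (s : nat) (p : 'I_s.+1 -> nat) (alpha beta : 'I_s.+1 -> nat),
  [/\ p ord0 = 2, injective p,
      forall i, i != ord0 -> prime (p i) /\ odd (p i),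
      1 <= alpha ord0 /\ 1 <= beta ord0
    & n = \prod_i p i ^ alpha i /\ m = \prod_i p i ^ beta i].
Proof.
move=> n0 m0 en em.
pose l := [seq r <- primes (n * m) | odd r].
pose p (i : 'I_(size l).+1) := nth 0 (2 :: l) i.
have ul : uniq (2 :: l) by rewrite /= mem_filter filter_uniq ?primes_uniq.
have pl : {in 2 :: l, forall r, prime r}.
  by move=> r; rewrite inE mem_filter mem_primes => /predU1P[->//|/and4P[]].
have prodE N : 0 < N -> N %| n * m -> N = \prod_i p i ^ logn (p i) N.
  move=> N0 Nnm; rewrite [LHS](@prod_logn (2 :: l)) //.
    by rewrite (big_nth 0) big_mkord.
  move=> r; rewrite inE mem_filter !mem_primes => /and3P[pr _ rN].
  rewrite pr muln_gt0 n0 m0 (dvdn_trans rN Nnm) !andbT /=.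
  by case: (even_prime pr) => ->; rewrite ?orbT.
exists (size l), p, (fun i => logn (p i) n), (fun i => logn (p i) m); split=> //.
- move=> i j /eqP; rewrite nth_uniq //; first by move=> /eqP/val_inj.
- move=> i i0; have : p i \in l.
    by rewrite /p; case: i i0 => [[|i] //= ilt] _; apply: mem_nth.
  by rewrite mem_filter mem_primes => /and4P[].
- by rewrite !logn_gt0 !mem_primes n0 m0 !dvdn2 en em.
- by split; apply: prodE => //; [apply: dvdn_mulr | apply: dvdn_mull].
Qed.

End Factorization.

(** * Rotations and their torsion *)

Section Rotations.
Variable K : realType.
Local Open Scope ring_scope.
Implicit Types (s t : K) (g : SO2 K) (N k : nat).

Lemma rotD s t : rot (s + t) = (rot s * rot t)%g.
Proof.
apply: val_inj; apply/matrixP => i j.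
rewrite !mxE !big_ord_recl big_ord0 !mxE cosD sinD.
by case: i j => [[|[|//]] ?] [[|[|//]] ?] /=; ring.
Qed.

Lemma rot0 : rot (0 : K) = 1%g.
Proof.
apply: val_inj; apply/matrixP => i j; rewrite !mxE cos0 sin0 oppr0.
by case: i j => [[|[|//]] ?] [[|[|//]] ?].
Qed.

Lemma rotN t : rot (- t) = (rot t)^-1%g.
Proof. by apply: (mulgI (rot t)); rewrite -rotD subrr rot0 mulgV. Qed.

Lemma rotX t k : rot (t *+ k) = (rot t ^+ k)%g.
Proof.
elim: k => [|k IHk]; first by rewrite mulr0n rot0 expg0.
by rewrite mulrS expgS rotD IHk.
Qed.

(** The first row [(a, b)] is a unit vector; its angle is [acos a] up to the sign
given by [b].  Orthogonality and determinant 1 determine the second row. *)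
Lemma rot_surj g : exists t, g = rot t.
Proof.
case: g => A isA.
have /andP[/eqP oA /eqP dA] := isA.
pose a := A ord0 ord0; pose b := A ord0 ord_max.
pose c := A ord_max ord0; pose d := A ord_max ord_max.
have l0 : lift ord0 (ord0 : 'I_1) = ord_max :> 'I_2 by apply: val_inj.
have ab : a ^+ 2 + b ^+ 2 = 1.
  have /matrixP/(_ ord0 ord0) := oA.
  rewrite !mxE !big_ord_recl big_ord0 !mxE l0 /= -/a -/b => e.
  by rewrite -[RHS](mulr1n 1) -[RHS]e; ring.
have ac : a * c + b * d = 0.
  have /matrixP/(_ ord0 ord_max) := oA.
  rewrite !mxE !big_ord_recl big_ord0 !mxE l0 /= -/a -/b -/c -/d => e.
  by rewrite -[RHS]e; ring.
have ad : a * d - b * c = 1.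
  rewrite -[RHS]dA (expand_det_row _ ord0) !big_ord_recl big_ord0 /cofactor.
  rewrite !det_mx11 !mxE /= !l0.
  have -> : lift ord_max (0 : 'I_1) = ord0 :> 'I_2 by apply: val_inj.
  by rewrite -/a -/b -/c -/d expr0 expr1; ring.
have eqd : d = a.
  transitivity (a * (a * d - b * c) + b * (a * c + b * d)).
    by rewrite -[LHS]mulr1 -ab; ring.
  by rewrite ad ac; ring.
have eqc : c = - b.
  transitivity (a * (a * c + b * d) - b * (a * d - b * c)).
    by rewrite -[LHS]mulr1 -ab; ring.
  by rewrite ad ac; ring.
have ha : -1 <= a <= 1 by apply/andP; split; nra.
have [t [ct st]] : exists t, cos t = a /\ sin t = b.
  have sq : Num.sqrt (1 - a ^+ 2) = `|b|.
    by rewrite -ab addrAC subrr add0r sqrtr_sqr.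
  case: (lerP 0 b) => b0.
    exists (acos a); rewrite acosK ?in_itv //= sin_acos // sq.
    by rewrite ger0_norm.
  exists (- acos a); rewrite cosN sinN acosK ?in_itv //= sin_acos // sq.
  by rewrite ltr0_norm // opprK.
exists t; apply: val_inj; apply/matrixP => i j; rewrite !mxE ct st.
case: i j => [[|[|//]] ?] [[|[|//]] ?] /=.
- by rewrite /a; congr (A _ _); apply: val_inj.
- by rewrite /b; congr (A _ _); apply: val_inj.
- by rewrite -eqc /c; congr (A _ _); apply: val_inj.
- by rewrite -eqd /d; congr (A _ _); apply: val_inj.
Qed.

Lemma SO2_commute g h : commute g h.
Proof.
have [s ->] := rot_surj g; have [t ->] := rot_surj h.
by rewrite /commute -!rotD addrC.
Qed.

Lemma rot_2piz (z : int) : rot (2 * pi * z%:~R : K) = 1%g.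
Proof.
have r1 : rot (2 * pi : K) = 1%g.
  apply: val_inj; apply/matrixP => i j; rewrite mulr_natl !mxE cos2pi sin2pi.
  by rewrite oppr0; case: i j => [[|[|//]] ?] [[|[|//]] ?].
case: z => k; first by rewrite -pmulrn mulr_natr rotX r1 expg1n.
by rewrite NegzE mulrNz mulrN rotN -pmulrn mulr_natr rotX r1 expg1n invg1.
Qed.

(** After subtracting a multiple of [2 * pi], the angle lies in [[0, 2 * pi[], and
[cos] is injective on each half of this interval up to reflection. *)
Lemma rot_eq1 t : rot t = 1%g -> exists z : int, t = 2 * pi * z%:~R.
Proof.
move=> t1; have pi0 := pi_gt0 K.
exists (Num.floor (t / (2 * pi))); set z := Num.floor _.
pose u := t - 2 * pi * z%:~R.
have u1 : rot u = 1%g by rewrite rotD rotN rot_2piz t1 mul1g invg1.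
have cu : cos u = 1.
  by have /(congr1 val)/matrixP/(_ ord0 ord0) := u1; rewrite !mxE.
have zle : z%:~R <= t / (2 * pi) by apply: ge_floor.
have zgt : t / (2 * pi) < z%:~R + 1.
  by have := floorD1_gt (t / (2 * pi)); rewrite intrD.
have u0 : 0 <= u.
  by move: zle; rewrite ler_pdivlMr ?mulr_gt0 // /u => ?; nra.
have u2 : u < 2 * pi.
  by move: zgt; rewrite ltr_pdivrMr ?mulr_gt0 // /u => ?; nra.
suff : u = 0 by rewrite /u; lra.
case: (lerP u pi) => upi.
  apply: cos_inj; rewrite ?cos0 ?in_itv //=; apply/andP; split; lra.
have : 2 * pi - u = 0.
  apply: cos_inj; rewrite ?cos0 ?in_itv //=; try by apply/andP; split; lra.
  by rewrite -cosN opprB -[2 * pi]mulr1 -(cosD2pi (u - _)) mulr_natl mulr1 subrK.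
lra.
Qed.

Definition zeta N : SO2 K := rot (2 * pi / N%:R).

Lemma zetaX N k : rot (2 * pi * k%:R / N%:R) = (zeta N ^+ k)%g.
Proof. by rewrite -rotX -mulr_natr; congr rot; ring. Qed.

Lemma zeta_dvd M N : (0 < N)%N -> (M %| N)%N -> (zeta N ^+ (N %/ M))%g = zeta M.
Proof.
move=> N0 /dvdnP[d eN]; move: N0; rewrite eN muln_gt0 => /andP[d0 M0].
rewrite -zetaX mulnK // /zeta natrM; congr rot; field.
by rewrite !pnatr_eq0 -!lt0n d0 M0.
Qed.

Lemma zetaX_eq1 N k : (0 < N)%N -> (zeta N ^+ k)%g = 1%g <-> (N %| k)%N.
Proof.
move=> N0; have NR : N%:R != 0 :> K by rewrite pnatr_eq0 -lt0n.
rewrite -zetaX; split => [/rot_eq1[z ez]|/dvdnP[d ->]].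
  have /mulfI : 2 * pi != 0 :> K by rewrite mulf_neq0 // ?lt0r_neq0 // pi_gt0.
  have e : 2 * pi * k%:R = 2 * pi * (z%:~R * N%:R) :> K.
    by rewrite mulrA -ez mulfVK.
  move=> /(_ _ _ e) {e}.
  rewrite !pmulrn -intrM => /eqP; rewrite eqr_int => /eqP ek.
  by have : (N%:Z %| k%:Z)%Z by apply/dvdzP; exists z.
have -> : 2 * pi * (d * N)%:R / N%:R = 2 * pi * (Posz d)%:~R :> K.
  by rewrite -pmulrn natrM; field.
exact: rot_2piz.
Qed.

(** The solutions of [g ^+ N = 1] are the rotations by [2 * pi * z / N] with [z]
an integer, and [z] counts modulo [N]. *)
Lemma CN_torsion N : (0 < N)%N -> CN K N = [set g | (g ^+ N)%g = 1%g]%classic.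
Proof.
move=> N0; have NR : N%:R != 0 :> K by rewrite pnatr_eq0 -lt0n.
have z1 : (zeta N ^+ N)%g = 1%g by apply/zetaX_eq1.
apply/seteqP; split => g /= [].
  by move=> r _ <-; rewrite zetaX -expgnA mulnC expgnA z1 expg1n.
have [t ->] := rot_surj g; rewrite -rotX => /rot_eq1[z ez].
exists `|(z %% N%:Z)%Z|%N.
  rewrite /= -ltz_nat gez0_abs ?modz_ge0 ?ltz_pmod //.
  by rewrite -lt0n.
have et : t = 2 * pi * z%:~R / N%:R by rewrite -ez -[t *+ N]mulr_natr mulfK.
have := divz_eq z N%:Z; set q := (z %/ _)%Z => eqz.
have -> : t = 2 * pi * q%:~R + 2 * pi * `|(z %% N)%Z|%N%:R / N%:R.
  rewrite et [in LHS]eqz intrD intrM -!pmulrn natr_absz ger0_norm ?modz_ge0 -?lt0n //.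
  field; exact: NR.
by rewrite rotD rot_2piz mul1g.
Qed.

Lemma zetaE N k : (zeta N ^+ k)%g = rot (2 * pi / N%:R * k%:R).
Proof. by rewrite -zetaX; congr rot; ring. Qed.

Lemma negI_neq1 : negI K <> 1%g.
Proof.
move=> /(congr1 val)/matrixP/(_ ord0 ord0); rewrite !mxE /= mulr1n; lra.
Qed.

Lemma negI_square : (negI K ^+ 2)%g = 1%g.
Proof.
by rewrite expg2; apply: val_inj; rewrite /= mulNmx mulmxN opprK mulmx1.
Qed.

End Rotations.

Section FiniteRotations.
Variable K : realType.
Local Open Scope group_scope.
Implicit Types (a x : SO2 K) (g : SO2 K * SO2 K) (n m N : nat).

Lemma SO2pair_commute g g' : commute g g'.
Proof.
by case: g g' => [a b] [a' b']; congr (_, _); apply: SO2_commute.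
Qed.

Lemma zeta_order N : 0 < N -> has_order (zeta K N) N.
Proof. by move=> N0 k; apply: zetaX_eq1. Qed.

Lemma zeta_gen N a : 0 < N -> a ^+ N = 1 -> exists u, a = zeta K N ^+ u.
Proof.
move=> N0 aN; have : CN K N a by rewrite CN_torsion.
by case=> r _ <-; exists r; rewrite zetaX.
Qed.

Lemma CN_generator N x : 0 < N -> cyc x = CN K N ->
  has_order x N /\ forall a, a ^+ N = 1 -> exists u, a = x ^+ u.
Proof.
move=> N0 xN; have x1 : x ^+ N = 1.
  by have := cyc_id x; rewrite xN CN_torsion.
have gen a : a ^+ N = 1 -> exists u, a = x ^+ u.
  by move=> aN; apply/(cycP N0 x1); rewrite xN CN_torsion.
split=> // k; split=> [xk|/dvdnP[d ->]]; last by rewrite mulnC expgnA x1 expg1n.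
apply/(zeta_order N0); have [|u ->] := gen (zeta K N).
  exact/zeta_order.
by rewrite expgnAC xk expg1n.
Qed.

Lemma generator_div N d x a : 0 < N -> d %| N -> has_order x N ->
    (forall a, a ^+ N = 1 -> exists u, a = x ^+ u) ->
  a ^+ d = 1 -> exists u, a = (x ^+ (N %/ d)) ^+ u.
Proof.
move=> N0 dN ox gen ad; have [|u au] := gen a.
  by rewrite -(divnK dN) mulnC expgnA ad expg1n.
have [|r _ ur] := @expg_torsion _ x N N0 ox d u dN; first by rewrite -au.
by exists r; rewrite au ur mulnC expgnA.
Qed.

(** With [n] the order of a cyclic group and [c] prime to [d], the [d]-torsion of
the group lies in its subgroup of order [q]. *)
Lemma torsion_coprime_part n q d c a : 0 < n -> n = (q * c)%N ->
  q %| d -> coprime c d -> a ^+ n = 1 -> a ^+ d = 1 -> a ^+ q = 1.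
Proof.
move=> n0 nE qd cd an; have [u ->] := zeta_gen n0 an.
rewrite -!expgnA => /(zeta_order n0) ud; apply/(zeta_order n0).
rewrite nE mulnC; apply: dvdn_mul => //.
by rewrite -(Gauss_dvdl _ cd); apply: dvdn_trans ud; rewrite nE dvdn_mull.
Qed.

Lemma twisted_cyc k r :
  twisted K k r = cyc (zeta K (2 ^ k) ^+ r, zeta K (2 ^ k)).
Proof.
have k0 : 0 < 2 ^ k by rewrite expn_gt0.
have zk := has_order_id (zeta_order k0).
have gE i : (rot (2 * pi / (2 ^ k)%:R * r%:R * i%:R)%R,
             rot (2 * pi / (2 ^ k)%:R * i%:R)%R) =
            (zeta K (2 ^ k) ^+ r, zeta K (2 ^ k)) ^+ i.
  by rewrite pairX -expgnA !zetaE natrM mulrA.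
have gk : (zeta K (2 ^ k) ^+ r, zeta K (2 ^ k)) ^+ (2 ^ k)%N = 1.
  by rewrite pairX expgnAC zk expg1n.
apply/seteqP; split=> [_ [i _ <-]|g]; first by rewrite gE; exists i; left.
case/(cycP k0 gk) => i ->; exists (i %% 2 ^ k); first by rewrite /= ltn_pmod.
by rewrite gE; apply: (eq_expg_mod gk); rewrite modn_mod.
Qed.

(** The second components form the group generated by [zeta K (2 ^ k)], which
determines [k]; comparing the elements with second component [zeta K (2 ^ k)]
then determines [r] modulo [2 ^ k]. *)
Lemma twisted_inj k k' r r' : twisted K k r = twisted K k' r' ->
  r < 2 ^ k -> r' < 2 ^ k' -> k = k' /\ r = r'.
Proof.
have le k1 r1 k2 r2 : twisted K k1 r1 = twisted K k2 r2 -> k1 <= k2.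
  rewrite !twisted_cyc => eqT; set z1 := zeta K (2 ^ k1) in eqT.
  set z2 := zeta K (2 ^ k2) in eqT.
  have k20 : 0 < 2 ^ k2 by rewrite expn_gt0.
  have z2k : z2 ^+ (2 ^ k2)%N = 1 by apply/zeta_order.
  have g2k : (z2 ^+ r2, z2) ^+ (2 ^ k2)%N = 1.
    by rewrite pairX expgnAC z2k expg1n.
  have : cyc (z2 ^+ r2, z2) (z1 ^+ r1, z1) by rewrite -eqT; apply: cyc_id.
  case/(cycP k20 g2k) => i; rewrite pairX => -[_ z1i].
  rewrite -(@dvdn_Pexp2l 2) //; apply/(@zeta_order (2 ^ k1)).
    by rewrite expn_gt0.
  by rewrite -/z1 z1i expgnAC z2k expg1n.
move=> eqT; have kk : k = k'.
  by apply/eqP; rewrite eqn_leq (le _ _ _ _ eqT) (le _ _ _ _ (esym eqT)).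
subst k'; move: eqT; rewrite !twisted_cyc; set z := zeta K (2 ^ k) => eqT rk rk'.
have k0 : 0 < 2 ^ k by rewrite expn_gt0.
have oz : has_order z (2 ^ k) by apply: zeta_order.
have zk := has_order_id oz.
split=> //; have : cyc (z ^+ r', z) (z ^+ r, z) by rewrite -eqT; apply: cyc_id.
have gk : (z ^+ r', z) ^+ (2 ^ k)%N = 1 by rewrite pairX expgnAC zk expg1n.
case/(cycP k0 gk) => i; rewrite pairX => -[zr zi].
have {zr} zr : z ^+ r = z ^+ r' by rewrite zr expgnAC -zi.
have inj r1 r2 : r1 <= r2 -> r2 < 2 ^ k -> z ^+ r1 = z ^+ r2 -> r1 = r2.
  move=> r12 r2k z12; apply/eqP; rewrite eqn_leq r12 -subn_eq0.
  apply: contraLR r2k; rewrite -lt0n -leqNgt => sub0.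
  apply: leq_trans (leq_subr r1 r2); apply: dvdn_leq => //.
  by apply/oz; rewrite expgnFr // z12 mulgV.
case: (leqP r r') => rr; first exact: inj.
by apply/esym/inj => //; apply: ltnW.
Qed.

End FiniteRotations.

(** * Decomposition of the cyclic subgroups *)

Section PrimaryFactorization.
Variables (K : realType) (s : nat) (p : 'I_s -> nat).
Hypotheses (pr_p : forall i, prime (p i)) (inj_p : injective p).

Lemma coprime_primary i j k l : i != j -> coprime (p i ^ k) (p j ^ l).
Proof.
move=> ij; apply/coprimeXl/coprimeXr.
by rewrite prime_coprime // dvdn_prime2 // (inj_eq inj_p).
Qed.

(** The inclusions give [p i ^ e i %| N] for all [i], and the decomposition of
the generator [zeta K N] shows that it is killed by the product. *)
Lemma primary_factorization (N : nat) (e : 'I_s -> nat) : 0 < N ->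
    (forall i, CN K (p i ^ e i) `<=` CN K N)%classic ->
    (forall a, CN K N a -> exists2 h : 'I_s -> SO2 K,
       forall i, CN K (p i ^ e i) (h i) & a = (\prod_(i < s) h i)%g) ->
  N = \prod_(i < s) p i ^ e i.
Proof.
move=> N0 subN genN.
have pe0 i : 0 < p i ^ e i by rewrite expn_gt0 prime_gt0.
have P0 : 0 < \prod_(i < s) p i ^ e i by apply: prodn_gt0.
have zN : (zeta K N ^+ N = 1)%g by apply/zeta_order.
apply/eqP; rewrite eqn_dvd; apply/andP; split.
  have [|h hp zh] := genN (zeta K N); first by rewrite CN_torsion.
  apply/(zeta_order K N0); rewrite zh.
  rewrite (prodgX (@SO2_commute K)) big1 // => i _.
  have := hp i; rewrite CN_torsion // (bigD1 i) //= => hi.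
  by rewrite expgnA hi expg1n.
have : N = 0 %[mod \prod_(i < s) p i ^ e i].
  apply: eq_mod_prod => [i j|i]; first exact: coprime_primary.
  rewrite mod0n; apply/eqP/(zeta_order K (pe0 i)).
  have : CN K N (zeta K (p i ^ e i)).
    by apply: (subN i); rewrite CN_torsion //; apply/zeta_order.
  by rewrite CN_torsion.
by rewrite mod0n => /eqP.
Qed.

End PrimaryFactorization.

Section CyclicDecomposition.
Variables (K : realType) (n m s : nat) (p alpha beta : 'I_s.+1 -> nat).
Hypotheses (n_gt0 : 0 < n) (m_gt0 : 0 < m).
Hypotheses (p0 : p ord0 = 2) (inj_p : injective p).
Hypothesis pr_p : forall i, prime (p i).
Hypothesis alpha0 : 0 < alpha ord0.
Hypotheses (nE : n = \prod_i p i ^ alpha i) (mE : m = \prod_i p i ^ beta i).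

Local Notation L := (CN K n `*` CN K m)%classic.
Local Notation P := (primary_part K p alpha beta).
Let q i := p i ^ maxn (alpha i) (beta i).

Let q_gt0 i : 0 < q i. Proof. by rewrite expn_gt0 prime_gt0. Qed.

Let co_q i j : i != j -> coprime (q i) (q j).
Proof. exact: coprime_primary. Qed.

Let commL : forall g h : SO2 K * SO2 K, commute g h := @SO2pair_commute K.

Lemma memL g : L g <-> (g.1 ^+ n = 1 /\ g.2 ^+ m = 1)%g.
Proof. by rewrite !CN_torsion. Qed.

Lemma L_subgroup : is_subgroup L.
Proof.
apply/is_subgroupP; split=> [|g h]; first by apply/memL; rewrite !expg1n.
move=> /memL[g1 g2] /memL[h1 h2]; apply/memL; split=> /=.
  by rewrite expgMn ?expVgn ?g1 ?h1 ?mulgV //; apply: SO2_commute.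
by rewrite expgMn ?expVgn ?g2 ?h2 ?mulgV //; apply: SO2_commute.
Qed.

Let prod_dvd_q (e : 'I_s.+1 -> nat) :
  (forall i, e i <= maxn (alpha i) (beta i)) ->
  \prod_i p i ^ e i %| \prod_i q i.
Proof.
move=> le_e; elim/big_rec2: _ => // i x y _ xy.
by apply: dvdn_mul => //; apply: dvdn_exp2l.
Qed.

Lemma L_torsion g : L g -> (g ^+ (\prod_i q i)%N = 1)%g.
Proof.
move=> /memL[g1 g2]; rewrite (surjective_pairing g) pairX; congr (_, _).
  have /dvdnP[d ->] : n %| \prod_i q i.
    by rewrite nE; apply: prod_dvd_q => i; apply: leq_maxl.
  by rewrite mulnC expgnA g1 expg1n.
have /dvdnP[d ->] : m %| \prod_i q i.
  by rewrite mE; apply: prod_dvd_q => i; apply: leq_maxr.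
by rewrite mulnC expgnA g2 expg1n.
Qed.

(** The exponent [p i ^ e i] is the [p i]-part of [N], so the larger torsion
exponent [q i] does not add anything inside [CN K N]. *)
Let CN_primary N (e : 'I_s.+1 -> nat) i (a : SO2 K) :
    0 < N -> N = \prod_i p i ^ e i -> e i <= maxn (alpha i) (beta i) ->
  (a ^+ (p i ^ e i)%N = 1 <-> a ^+ N = 1 /\ a ^+ q i = 1)%g.
Proof.
move=> N0 NE ei; split=> [ai|[aN aq]].
  split; first by rewrite NE (bigD1 i) //= expgnA ai expg1n.
  by rewrite /q -(subnKC ei) expnD expgnA ai expg1n.
apply: (@torsion_coprime_part _ N _ (q i) (\prod_(j | j != i) p j ^ e j)) => //.
- by rewrite NE (bigD1 i).
- exact: dvdn_exp2l.
rewrite coprime_sym; apply: coprime_prod => j ji.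
by apply: coprime_primary => //; rewrite eq_sym.
Qed.

Lemma memP i g :
  P i g <-> (g.1 ^+ (p i ^ alpha i)%N = 1 /\ g.2 ^+ (p i ^ beta i)%N = 1)%g.
Proof.
by rewrite /primary_part !CN_torsion ?expn_gt0 ?prime_gt0.
Qed.

Lemma primary_partE i : P i = (L `&` torsion (q i))%classic.
Proof.
apply/seteqP; split=> g.
  move=> /memP[/(CN_primary g.1 n_gt0 nE (leq_maxl _ _))[g1n g1q]].
  move=> /(CN_primary g.2 m_gt0 mE (leq_maxr _ _))[g2m g2q].
  split; first exact/memL.
  by rewrite /torsion /= (surjective_pairing g) pairX g1q g2q.
move=> [/memL[g1 g2]]; rewrite /torsion /= (surjective_pairing g) pairX.
move=> -[q1 q2]; apply/memP; split=> /=.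
  by apply/(CN_primary g.1 n_gt0 nE (leq_maxl _ _)).
by apply/(CN_primary g.2 m_gt0 mE (leq_maxr _ _)).
Qed.

Lemma primary_dprod : internal_dprod P L.
Proof.
have -> : P = (fun i => L `&` torsion (q i))%classic.
  by apply/funext => i; apply: primary_partE.
by apply: torsion_dprod => //; [apply: L_subgroup | apply: L_torsion].
Qed.

Variable C : set (SO2 K * SO2 K).
Hypothesis CL : cyclic_subgroup_of L C.
Hypothesis CI : C (negI K, negI K).

Let A i : set (SO2 K * SO2 K) := (C `&` torsion (q i))%classic.

Let C_torsion g : C g -> (g ^+ (\prod_i q i)%N = 1)%g.
Proof. by move=> Cg; apply: L_torsion; case: CL => _ sub _; apply: sub. Qed.

Let A_dprod : internal_dprod A C.
Proof.
by apply: torsion_dprod => //; case: CL.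
Qed.

Let A_sub i : (A i `<=` P i)%classic.
Proof.
by move=> g [Cg tg]; rewrite primary_partE; split=> //; case: CL => _ sub _; apply: sub.
Qed.

Let A_cyclic i : exists g, A i = cyc g.
Proof.
have [_ _ [g Cg]] := CL.
have [|k Ak] := cyc_torsion commL q_gt0 co_q (g := g) i.
  by apply: C_torsion; rewrite Cg; apply: cyc_id.
by exists (g ^+ k)%g; rewrite -Ak /A Cg.
Qed.

Let negI_A0 : A ord0 (negI K, negI K).
Proof.
split=> //; rewrite /torsion /= pairX /q p0 -(@prednK (maxn _ _)).
  by rewrite expnS expgnA negI_square expg1n.
by rewrite leq_max alpha0.
Qed.

(** Used with the standard generators for the shape of the factor at 2, and with
powers of [x] and [y] for the generator of [C]. *)
Lemma dyadic_factor (x y : SO2 K) :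
    has_order x (2 ^ alpha ord0) -> has_order y (2 ^ beta ord0) ->
    (forall a, a ^+ (2 ^ alpha ord0)%N = 1 -> exists u, a = x ^+ u)%g ->
    (forall a, a ^+ (2 ^ beta ord0)%N = 1 -> exists u, a = y ^+ u)%g ->
  exists k r, [/\ 1 <= k <= minn (alpha ord0) (beta ord0), twist_params k r
    & A ord0 = cyc ((x ^+ (r * 2 ^ (alpha ord0 - k))%N)%g,
                    (y ^+ (2 ^ (beta ord0 - k))%N)%g)].
Proof.
move=> ox oy genx geny; have [g Ag] := A_cyclic ord0.
have /A_sub/memP : A ord0 g by rewrite Ag; apply: cyc_id.
rewrite p0 => -[/genx[u gu] /geny[v gv]].
have gE : g = (x ^+ u, y ^+ v)%g by rewrite (surjective_pairing g) gu gv.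
have := negI_A0; rewrite Ag gE => /(dyadic_normal_form ox oy).
by apply=> //; [apply: negI_neq1 | apply: negI_neq1 | apply: negI_square
  | apply: negI_square].
Qed.

Lemma twist_params_lt k r : twist_params k r -> r < 2 ^ k.
Proof. by case=> /= /andP[_ rk] _; move: rk; rewrite leq_subRL ?expn_gt0. Qed.

Lemma cyclic_decomposition_exists_unique :
  exists (B : 'I_s.+1 -> set (SO2 K * SO2 K)) (kappa r : nat),
    cyclic_decomposition p alpha beta C B kappa r
    /\ forall B' kappa' r',
         cyclic_decomposition p alpha beta C B' kappa' r' ->
         [/\ B' = B, kappa' = kappa & r' = r].
Proof.
have ex2 e : 0 < 2 ^ e by rewrite expn_gt0.
have [||||k [r [kab rk A0]]] := @dyadic_factor
  (zeta K (2 ^ alpha ord0)) (zeta K (2 ^ beta ord0)).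
- exact: zeta_order.
- exact: zeta_order.
- by move=> a; apply: zeta_gen.
- by move=> a; apply: zeta_gen.
have {}A0 : A ord0 = twisted K k r.
  have /andP[_] := kab; rewrite leq_min => /andP[ka kb].
  by rewrite A0 twisted_cyc mulnC expgnA !expnB // !zeta_dvd ?dvdn_exp2l.
exists A, k, r; split.
  split=> // i; split; [|exact: A_sub|exact: A_cyclic].
  by have [sA _ _ _] := A_dprod; apply: sA.
move=> B k' r' [dB subB _ rk' B0].
have BA : B = A.
  apply/funext => i; apply: internal_dprod_torsion dB _ i => // j g Bg.
  have [_ subP _] := subB j.
  by have := subP _ Bg; rewrite primary_partE => -[].
have eqT : twisted K k' r' = twisted K k r by rewrite -B0 BA.
by have [] := twisted_inj eqT (twist_params_lt rk') (twist_params_lt rk).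
Qed.

Lemma cyclic_generator (x y : SO2 K) :
    cyc x = CN K n -> cyc y = CN K m ->
  exists (nu chi tau psi : nat) (sigma : {perm 'I_s.+1})
         (k r rho j : 'I_s.+1 -> nat),
    let p' i := p (sigma i) in
    let a i := alpha (sigma i) in
    let b i := beta (sigma i) in
    admissible p' a b k r rho j nu chi tau psi
    /\ C = cyc ((x ^+ exponentA p' a k r j nu chi tau psi n)%g,
                (y ^+ exponentB p' b k rho j nu chi tau psi m)%g).
Proof.
move=> /(CN_generator n_gt0)[ox genx] /(CN_generator m_gt0)[oy geny].
have an i : p i ^ alpha i %| n by rewrite nE (bigD1 i) //= dvdn_mulr.
have bm i : p i ^ beta i %| m by rewrite mE (bigD1 i) //= dvdn_mulr.
pose X i := (x ^+ (n %/ p i ^ alpha i))%g.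
pose Y i := (y ^+ (m %/ p i ^ beta i))%g.
have oX i : has_order (X i) (p i ^ alpha i) by apply: has_order_div.
have oY i : has_order (Y i) (p i ^ beta i) by apply: has_order_div.
have genX i a : (a ^+ (p i ^ alpha i)%N = 1)%g -> exists u, a = (X i ^+ u)%g.
  exact: generator_div.
have genY i a : (a ^+ (p i ^ beta i)%N = 1)%g -> exists u, a = (Y i ^+ u)%g.
  exact: generator_div.
(* z collects the case, the exponent k and the parameter of the prime p i. *)
have block i : exists z : nat * nat * nat,
    [/\ z.1.1 < 4, block_restr (p i) (alpha i) (beta i) z.1.1 z.1.2 z.2,
        A i = cyc ((X i ^+ block_expA (p i) (alpha i) z.1.1 z.1.2 z.2)%g,
                   (Y i ^+ block_expB (p i) (beta i) z.1.1 z.1.2 z.2)%g)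
      & i = ord0 -> [/\ z.1.1 = 0,
          1 <= z.1.2 <= minn (alpha i) (beta i) & twist_params z.1.2 z.2]].
  have [->|i0] := eqVneq i ord0.
    have [||||k [r [kab rk A0]]] := @dyadic_factor (X ord0) (Y ord0).
    - by have := oX ord0; rewrite p0.
    - by have := oY ord0; rewrite p0.
    - by move=> a; have := @genX ord0 a; rewrite p0.
    - by move=> a; have := @genY ord0 a; rewrite p0.
    exists (0, k, r); split=> //=; last by rewrite p0.
    rewrite p0; split; first by case/andP: kab.
    by have := twist_params_lt rk; rewrite leq_subRL ?expn_gt0.
  have [g Ag] := A_cyclic i.
  have /A_sub/memP[/genX[u gu] /genY[v gv]] : A i g by rewrite Ag; apply: cyc_id.
  have [ty [k [t [ty4 restr cE]]]] :=
    block_normal_form (pr_p i) (oX i) (oY i) u v.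
  exists (ty, k, t); split=> //=; last by move=> /eqP; rewrite (negPf i0).
  by rewrite Ag (surjective_pairing g) gu gv.
have {block} [z zP] := fin_all_exists block.
pose ty i := (z i).1.1; pose k i := (z i).1.2; pose t i := (z i).2.
have [sigma sigmaP] := sorting_perm ty.
(* The first cnt c sorted indices are those of the cases below c. *)
pose cnt c := #|[pred j | ty j < c]|.
have cnt_mono c : cnt c <= cnt c.+1.
  by apply: subset_leq_card; apply/fintype.subsetP => i; rewrite !inE; apply: leqW.
pose nu := cnt 1; pose chi := cnt 2 - nu; pose tau := cnt 3 - cnt 2.
pose psi := cnt 4 - cnt 3.
have chiE : nu + chi = cnt 2 by rewrite subnKC // cnt_mono.
have tauE : nu + chi + tau = cnt 3 by rewrite chiE subnKC // cnt_mono.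
have psiE : nu + chi + tau + psi = cnt 4 by rewrite tauE subnKC // cnt_mono.
have ty4 i : ty (sigma i) < 4 by case: (zP (sigma i)).
have in1 (i : 'I_s.+1) : (i < nu) = (ty (sigma i) < 1) by apply: sigmaP.
have in2 (i : 'I_s.+1) : (i < nu + chi) = (ty (sigma i) < 2).
  by rewrite chiE; apply: sigmaP.
have in3 (i : 'I_s.+1) : (i < nu + chi + tau) = (ty (sigma i) < 3).
  by rewrite tauE; apply: sigmaP.
have in4 (i : 'I_s.+1) : (i < nu + chi + tau + psi) = (ty (sigma i) < 4).
  by rewrite psiE; apply: sigmaP.
pose ks i := k (sigma i); pose ts i := t (sigma i).
(* Each case uses only one of r, rho and j, so one function serves for all. *)
exists nu, chi, tau, psi, sigma, ks, ts, ts, ts => p' a b.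
have reindex (f : 'I_s.+1 -> nat) : \sum_i f (sigma i) = \sum_i f i.
  by rewrite [RHS](reindex_inj (@perm_inj _ sigma)).
split.
  have s0 : sigma (sigma^-1%g ord0) = ord0 by rewrite permKV.
  have [_ _ _ /(_ erefl)[ty0 k0 t0]] := zP ord0.
  apply: (@admissible_blocks _ p' a b ks ts (ty \o sigma) _ _ _ _
    _ _ _ _ (sigma^-1 ord0)%g) => //=; rewrite /p' /a /b /ks /ts ?s0 //.
    by rewrite psiE -[X in _ <= X]card_ord; apply: max_card.
  by move=> i; case: (zP (sigma i)).
rewrite (@exponentA_blocks _ p' a ks ts (ty \o sigma)) //.
rewrite (@exponentB_blocks _ p' b ks ts (ty \o sigma)) //.
rewrite (reindex (fun i => block_expA (p i) (alpha i) (ty i) (k i) (t i)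
                           * (n %/ p i ^ alpha i))).
rewrite (reindex (fun i => block_expB (p i) (beta i) (ty i) (k i) (t i)
                           * (m %/ p i ^ beta i))).
pose g i := ((X i ^+ block_expA (p i) (alpha i) (ty i) (k i) (t i))%g,
             (Y i ^+ block_expB (p i) (beta i) (ty i) (k i) (t i))%g).
rewrite (internal_dprod_cyc commL q_gt0 co_q (g := g) A_dprod).
- rewrite (surjective_pairing (\prod_i g i)%g); congr (cyc (_, _)).
    rewrite (big_morph fst (id1 := 1%g) (op1 := *%g)) // -prodgXr.
    by apply: eq_bigr => i _; rewrite /= mulnC expgnA.
  rewrite (big_morph snd (id1 := 1%g) (op1 := *%g)) // -prodgXr.
  by apply: eq_bigr => i _; rewrite /= mulnC expgnA.
- by move=> i; case: (zP i).
- move=> i; have [_ _ Ai _] := zP i.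
  suff [] : A i (g i) by [].
  by rewrite Ai; apply: cyc_id.
Qed.

End CyclicDecomposition.

Theorem proposition14 (K : realType) (n m : nat)
    (n_gt0 : (0 < n)%N) (m_gt0 : (0 < m)%N)
    (n_even : ~~ odd n) (m_even : ~~ odd m) :
  (exists (s : nat) (p alpha beta : 'I_s.+1 -> nat),
      primary_decomposition K n m p alpha beta)
  /\
  forall (s : nat) (p alpha beta : 'I_s.+1 -> nat),
    primary_decomposition K n m p alpha beta ->
    forall C : set (SO2 K * SO2 K),
      cyclic_subgroup_of (CN K n `*` CN K m)%classic C ->
      C (negI K, negI K) ->
      (exists (A : 'I_s.+1 -> set (SO2 K * SO2 K)) (kappa r : nat),
          cyclic_decomposition p alpha beta C A kappa r
          /\ forall A' kappa' r',
               cyclic_decomposition p alpha beta C A' kappa' r' ->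
               [/\ A' = A, kappa' = kappa & r' = r])
      /\
      (forall x y : SO2 K, cyc x = CN K n -> cyc y = CN K m ->
        exists (nu chi tau psi : nat) (sigma : {perm 'I_s.+1})
            (k r rho j : 'I_s.+1 -> nat),
          let p' i := p (sigma i) in
          let a i := alpha (sigma i) in
          let b i := beta (sigma i) in
          admissible p' a b k r rho j nu chi tau psi
          /\ C = cyc ((x ^+ exponentA p' a k r j nu chi tau psi n)%g,
                      (y ^+ exponentB p' b k rho j nu chi tau psi m)%g)).
Proof.
have prime_p s (p : 'I_s.+1 -> nat) : p ord0 = 2 ->
    (forall i, i != ord0 -> prime (p i) /\ odd (p i)) -> forall i, prime (p i).
  move=> p0 odd_p i; have [->|/odd_p[] //] := eqVneq i ord0.
  by rewrite p0.
split.
  have [s [p [alpha [beta [p0 inj_p odd_p ab0 [nE mE]]]]]] :=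
    prime_family_exists n_gt0 m_gt0 n_even m_even.
  exists s, p, alpha, beta; split=> //.
  by apply: primary_dprod => //; apply: prime_p.
move=> s p alpha beta [p0 inj_p odd_p [alpha0 beta0] dP].
have pr_p := prime_p s p p0 odd_p.
have [_ _ LE _] := dP.
have mem1 N : 0 < N -> CN K N 1%g by move=> N0; rewrite CN_torsion //= expg1n.
have pX0 i e : 0 < p i ^ e by rewrite expn_gt0 prime_gt0.
(* Elements (a, 1) and (1, a) isolate the two components of the decomposition. *)
have nE : n = \prod_i p i ^ alpha i.
  apply: (primary_factorization (K := K)) => // [i a Pa | a La].
    have [] := @internal_dprod_factor _ _ _ _ i dP (a, 1%g) => //.
    by split=> //; apply: mem1.
  have : (CN K n `*` CN K m)%classic (a, 1%g) by split=> //; apply: mem1.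
  rewrite LE => -[h hP /(congr1 fst) /= <-].
  exists (fun i => (h i).1) => [i|]; first by case: (hP i).
  exact: (big_morph fst).
have mE : m = \prod_i p i ^ beta i.
  apply: (primary_factorization (K := K)) => // [i a Pa | a La].
    have [] := @internal_dprod_factor _ _ _ _ i dP (1%g, a) => //.
    by split=> //; apply: mem1.
  have : (CN K n `*` CN K m)%classic (1%g, a) by split=> //; apply: mem1.
  rewrite LE => -[h hP /(congr1 snd) /= <-].
  exists (fun i => (h i).2) => [i|]; first by case: (hP i).
  exact: (big_morph snd).
move=> C CL CI; split.
  exact: (cyclic_decomposition_exists_unique n_gt0 m_gt0).
by move=> x y; apply: cyclic_generator.
Qed.
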